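(* Let $P$ be a TRAP. For $k\in\mathbb N_0$ and $p\in P(k,k)$ define the generalised trace $$\mathrm{Tr}_P(p):=t_{1,1}\circ\cdots\circ t_{k,k}(p)\in P(0,0).$$ 1. For any $(k,l)\in\mathbb N_0^2$ and any $(p,q)\in P(k,l)\times P(l,k)$, $\mathrm{Tr}_P(p\circ q)=\mathrm{Tr}_P(q\circ p)$. 2. For any $(k,l)\in\mathbb N_0^2$ and any $(p,q)\in P(k,k)\times P(l,l)$, $\mathrm{Tr}_P(p*q)=\mathrm{Tr}_P(p)*\mathrm{Tr}_P(q)$.
   Context: Notation: $\mathbb{N}_0=\{0,1,2,\dots\}$, $[k]=\{1,\dots,k\}$, $\mathfrak S_k$ is the symmetric group on $[k]$. TRAP. A TRAP is a family $P=(P(k,l))_{k,l\ge 0}$ of sets with: (1) for all $k,l\in\mathbb N_0$, a left action of $\mathfrak S_l$ and a right action of $\mathfrak S_k$ on $P(k,l)$ which commute. (2) Maps $*:P(k,l)\times P(k',l')\to P(k+k',l+l')$ (horizontal concatenation) such that: $*$ is associative; there is $I_0\in P(0,0)$ with $I_0*p=p*I_0=p$; $(\sigma\cdot p\cdot\tau)*(\sigma'\cdot p'\cdot\tau')=(\sigma\otimes\sigma')\cdot(p*p')\cdot(\tau\otimes\tau')$, where for $\alpha\in\mathfrak S_m,\beta\in\mathfrak S_n$, $(\alpha\otimes\beta)(i)=\alpha(i)$ if $i\le m$ and $\beta(i-m)+m$ if $i>m$; and $c_{l,l'}\cdot(p*p')=(p'*p)\cdot c_{k,k'}$ for $p\in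 P(k,l)$, $p'\in P(k',l')$, where $c_{m,n}\in\mathfrak S_{m+n}$, $c_{m,n}(i)=i+n$ if $i\le m$ and $i-m$ if $i>m$. (3) For $k,l\ge1$, $i\in[k]$, $j\in[l]$, maps $t_{i,j}:P(k,l)\to P(k-1,l-1)$ (partial trace maps) such that: (a) for $k,l\ge2$, $i\in[k]$, $j\in[l]$, $i'\in[k-1]$, $j'\in[l-1]$: $t_{i',j'}\circ t_{i,j}$ equals $t_{i-1,j-1}\circ t_{i',j'}$ if $i'<i,j'<j$; $t_{i,j-1}\circ t_{i'+1,j'}$ if $i'\ge i,j'<j$; $t_{i-1,j}\circ t_{i',j'+1}$ if $i'<i,j'\ge j$; $t_{i,j}\circ t_{i'+1,j'+1}$ if $i'\ge i,j'\ge j$. (b) $t_{i,j}(\sigma\cdot p\cdot\tau)=\sigma_j\cdot t_{\tau(i),\sigma^{-1}(j)}(p)\cdot\tau_{\tau(i)}$, where for $\alpha\in\mathfrak S_n$ and $q\in[n]$, $\alpha_q\in\mathfrak S_{n-1}$ is the permutation whose word is obtained from the word $\alpha(1)\dots\alpha(n)$ by deleting the letter $q$ and subtracting $1$ from all letters $>q$. (c) for $p\in P(k,l)$, $p'\in P(k',l')$ ($k,l,k',l'\ge0$), $i\in[k+k']$, $j\in[l+l']$: $t_{i,j}(p*p')=t_{i,j}(p)*p'$ if $i\le k,j\le l$, and $t_{i,j}(p*p')=p*t_{i-k,j-l}(p')$ if $i>k,j>l$. The vertical concatenation in $P$ is defined for $p\in P(k,l)$, $q\in P(l,m)$ by $q\circ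 p=t_{k+1,1}\circ\cdots\circ t_{k+l-1,l-1}\circ t_{k+l,l}(p*q)\in P(k,m)$. *)

(* Defs.v *)
From mathcomp Require Import all_boot all_fingroup.

Set Implicit Arguments.
Unset Strict Implicit.
Unset Printing Implicit Defensive.

Local Open Scope group_scope.
Local Open Scope nat_scope.

(* Conventions. Indices are 0-based: [n] = {1, ..., n} is 'I_n = {0, ..., n-1}.
   The product of {perm T} composes from left to right, (s * t) x = t (s x), so
   the functional composite of s and t (t first) is (t * s)%g. *)

Definition cast_fam (X : nat -> nat -> Type) k l k' l' (ek : k = k')
    (el : l = l') (x : X k l) : X k' l' :=
  let: erefl in _ = k1 := ek return X k1 l' in
  let: erefl in _ = l1 := el return X k l1 in x.

Section Permutations.

Definition perm_tens_fun m n (a : 'S_m) (b : 'S_n) (i : 'I_(m + n)) :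
    'I_(m + n) :=
  match split i with
  | inl i1 => lshift n (a i1)
  | inr i2 => rshift m (b i2)
  end.

Lemma perm_tens_inj m n (a : 'S_m) (b : 'S_n) : injective (perm_tens_fun a b).
Proof.
apply: (can_inj (g := perm_tens_fun a^-1 b^-1)) => i; rewrite /perm_tens_fun.
case: (split_ordP i) => j ->.
  by rewrite (unsplitK (inl _)) permK.
by rewrite (unsplitK (inr _)) permK.
Qed.

Definition perm_tens m n (a : 'S_m) (b : 'S_n) : 'S_(m + n) :=
  perm (@perm_tens_inj m n a b).

Definition block_swap_fun m n (i : 'I_(m + n)) : 'I_(m + n) :=
  match split i with
  | inl i1 => cast_ord (addnC n m) (rshift n i1)
  | inr i2 => cast_ord (addnC n m) (lshift m i2)
  end.

Lemma block_swapE m n (i : 'I_(m + n)) :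
  block_swap_fun i = (if i < m then i + n else i - m) :> nat.
Proof.
by rewrite /block_swap_fun; case: split_ordP => j -> /=; rewrite ?addKn // addnC.
Qed.

Lemma block_swap_inj m n : injective (@block_swap_fun m n).
Proof.
move=> i j /(congr1 val) /=; rewrite !block_swapE => e; apply: val_inj => /=.
have [hi hj] := (ltn_ord i, ltn_ord j); move: e.
case: ltnP => im; case: ltnP => jm e.
- exact: (addIn e).
- by move: hj; rewrite -(subnKC jm) -e addnA addnAC -ltn_subRL subnn.
- by move: hi; rewrite -(subnKC im) e addnA addnAC -ltn_subRL subnn.
- by rewrite -(subnKC im) e subnKC.
Qed.

Definition block_swap m n : 'S_(m + n) := perm (@block_swap_inj m n).

(* The letter q of the word a(0) ... a(n) sits at position a^-1 q: the i-th
   letter that remains is a (lift (a^-1 q) i), and unlift q lowers the letters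
   above q by one.  See perm_del_word. *)
Definition perm_del_fun n (a : 'S_n.+1) (q : 'I_n.+1) (i : 'I_n) : 'I_n :=
  odflt i (unlift q (a (lift (a^-1%g q) i))).

Lemma lift_perm_del_fun n (a : 'S_n.+1) (q : 'I_n.+1) (i : 'I_n) :
  lift q (perm_del_fun a q i) = a (lift (a^-1%g q) i).
Proof.
rewrite /perm_del_fun; case: unliftP => [j -> //|e].
have := neq_lift (a^-1%g q) i.
by rewrite -(inj_eq (@perm_inj _ a)) permKV e eqxx.
Qed.

Lemma perm_del_inj n (a : 'S_n.+1) (q : 'I_n.+1) : injective (perm_del_fun a q).
Proof.
move=> i j /(congr1 (lift q)); rewrite !lift_perm_del_fun.
by move/perm_inj/lift_inj.
Qed.

Definition perm_del n (a : 'S_n.+1) (q : 'I_n.+1) : 'S_n :=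
  perm (@perm_del_inj n a q).

Lemma perm_del_word n (a : 'S_n.+1) (q : 'I_n.+1) :
  [seq val (perm_del a q i) | i <- enum 'I_n] =
  [seq (if q < v then v.-1 else v)
     | v : nat <- [seq val (a i) | i <- enum 'I_n.+1] & v != q :> nat].
Proof.
have enumE (h : 'I_n.+1) :
    [seq i <- enum 'I_n.+1 | i != h] = [seq lift h i | i <- enum 'I_n].
  apply: (inj_map val_inj); apply: (irr_sorted_eq ltn_trans ltnn).
  - apply: (subseq_sorted ltn_trans (map_subseq _ (filter_subseq _ _))).
    by rewrite val_enum_ord iota_ltn_sorted.
  - rewrite -map_comp (map_comp (bump h) val) val_enum_ord.
    apply: (homo_sorted _ _ (iota_ltn_sorted 0 n)) => x y xy /=.
    by rewrite ltnNge leq_bump2 -ltnNge.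
  move=> v; apply/mapP/mapP => -[i].
    rewrite mem_filter => /andP[hi _] ->.
    case: (unliftP h i) hi => [j -> _|->]; last by rewrite eqxx.
    by exists (lift h j); rewrite // map_f // mem_enum.
  case/mapP=> j _ -> ->; exists (lift h j) => //.
  by rewrite mem_filter eq_sym neq_lift mem_enum.
rewrite filter_map -[RHS]map_comp.
rewrite (@eq_filter _ _ (fun i => i != a^-1%g q)); last first.
  by move=> i /=; rewrite (inj_eq val_inj) (canF_eq (permK a)).
rewrite enumE -[RHS]map_comp; apply: eq_map => i /=.
rewrite permE -lift_perm_del_fun /= /bump.
case: (leqP q (perm_del_fun a q i)) => h; first by rewrite add1n ltnS h.
by rewrite add0n ltnNge (ltnW h).
Qed.

End Permutations.

(* trap_tr carries the hypothesis k, l >= 1 in its type.  In the axioms on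
   iterated traces the values given to inord are always in range. *)
Record trap : Type := Trap {
  trap_car :> nat -> nat -> Type;
  trap_lact : forall k l, 'S_l -> trap_car k l -> trap_car k l;
  trap_ract : forall k l, trap_car k l -> 'S_k -> trap_car k l;
  trap_hcat : forall k l k' l', trap_car k l -> trap_car k' l' ->
    trap_car (k + k') (l + l');
  trap_unit : trap_car 0 0;
  trap_tr : forall k l, 'I_k.+1 -> 'I_l.+1 -> trap_car k.+1 l.+1 ->
    trap_car k l;

  trap_lact1 : forall k l (p : trap_car k l), trap_lact 1%g p = p;
  trap_lactM : forall k l (s s' : 'S_l) (p : trap_car k l),
    trap_lact (s' * s)%g p = trap_lact s (trap_lact s' p);
  trap_ract1 : forall k l (p : trap_car k l), trap_ract p 1%g = p;
  trap_ractM : forall k l (s s' : 'S_k) (p : trap_car k l),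
    trap_ract p (s' * s)%g = trap_ract (trap_ract p s) s';
  trap_actC : forall k l (s : 'S_l) (t : 'S_k) (p : trap_car k l),
    trap_ract (trap_lact s p) t = trap_lact s (trap_ract p t);

  trap_hcatA : forall k l k' l' k'' l'' (p : trap_car k l)
      (p' : trap_car k' l') (p'' : trap_car k'' l''),
    trap_hcat (trap_hcat p p') p'' =
    cast_fam (addnA k k' k'') (addnA l l' l'') (trap_hcat p (trap_hcat p' p''));
  trap_hcat1p : forall k l (p : trap_car k l), trap_hcat trap_unit p = p;
  trap_hcatp1 : forall k l (p : trap_car k l),
    cast_fam (addn0 k) (addn0 l) (trap_hcat p trap_unit) = p;
  trap_hcat_act : forall k l k' l' (s : 'S_l) (s' : 'S_l') (t : 'S_k)
      (t' : 'S_k') (p : trap_car k l) (p' : trap_car k' l'),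
    trap_hcat (trap_ract (trap_lact s p) t) (trap_ract (trap_lact s' p') t') =
    trap_ract (trap_lact (perm_tens s s') (trap_hcat p p')) (perm_tens t t');
  trap_hcatC : forall k l k' l' (p : trap_car k l) (p' : trap_car k' l'),
    trap_lact (block_swap l l') (trap_hcat p p') =
    trap_ract (cast_fam (addnC k' k) (addnC l' l) (trap_hcat p' p))
      (block_swap k k');

  trap_tr_ltlt : forall k l (i : 'I_k.+2) (j : 'I_l.+2) (i' : 'I_k.+1)
      (j' : 'I_l.+1) (p : trap_car k.+2 l.+2), i' < i -> j' < j ->
    trap_tr i' j' (trap_tr i j p) =
    trap_tr (inord i.-1) (inord j.-1) (trap_tr (inord i') (inord j') p);
  trap_tr_gelt : forall k l (i : 'I_k.+2) (j : 'I_l.+2) (i' : 'I_k.+1)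
      (j' : 'I_l.+1) (p : trap_car k.+2 l.+2), i' >= i -> j' < j ->
    trap_tr i' j' (trap_tr i j p) =
    trap_tr (inord i) (inord j.-1) (trap_tr (inord i'.+1) (inord j') p);
  trap_tr_ltge : forall k l (i : 'I_k.+2) (j : 'I_l.+2) (i' : 'I_k.+1)
      (j' : 'I_l.+1) (p : trap_car k.+2 l.+2), i' < i -> j' >= j ->
    trap_tr i' j' (trap_tr i j p) =
    trap_tr (inord i.-1) (inord j) (trap_tr (inord i') (inord j'.+1) p);
  trap_tr_gege : forall k l (i : 'I_k.+2) (j : 'I_l.+2) (i' : 'I_k.+1)
      (j' : 'I_l.+1) (p : trap_car k.+2 l.+2), i' >= i -> j' >= j ->
    trap_tr i' j' (trap_tr i j p) =
    trap_tr (inord i) (inord j) (trap_tr (inord i'.+1) (inord j'.+1) p);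

  trap_tr_act : forall k l (i : 'I_k.+1) (j : 'I_l.+1) (s : 'S_l.+1)
      (t : 'S_k.+1) (p : trap_car k.+1 l.+1),
    trap_tr i j (trap_ract (trap_lact s p) t) =
    trap_ract (trap_lact (perm_del s j) (trap_tr (t i) (s^-1%g j) p))
      (perm_del t (t i));

  trap_tr_hcatl : forall k l k' l' (i : 'I_k.+1) (j : 'I_l.+1)
      (p : trap_car k.+1 l.+1) (p' : trap_car k' l'),
    trap_tr (lshift k' i : 'I_(k + k').+1) (lshift l' j : 'I_(l + l').+1)
      (trap_hcat p p') =
    trap_hcat (trap_tr i j p) p';
  trap_tr_hcatr : forall k l k' l' (i : 'I_k'.+1) (j : 'I_l'.+1)
      (p : trap_car k l) (p' : trap_car k'.+1 l'.+1),
    trap_tr (cast_ord (addnS k k') (rshift k i))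
      (cast_ord (addnS l l') (rshift l j))
      (cast_fam (addnS k k') (addnS l l') (trap_hcat p p')) =
    trap_hcat p (trap_tr i j p')
}.

Section Operations.
Variable P : trap.

(* t_{k+1,1} o ... o t_{k+l,l} : P(k+l, l+m) -> P(k,m). *)
Fixpoint trap_contract k l m : P (k + l) (l + m) -> P k m :=
  match l return P (k + l) (l + m) -> P k m with
  | 0 => fun x => cast_fam (addn0 k) (erefl m) x
  | l'.+1 => fun x =>
      @trap_contract k l' m
        (@trap_tr P (k + l') (l' + m) ord_max (lshift m (@ord_max l'))
           (cast_fam (addnS k l') (erefl (l' + m).+1) x))
  end.

(* trap_vcomp q p is the vertical concatenation q o p. *)
Definition trap_vcomp k l m (q : P l m) (p : P k l) : P k m :=
  trap_contract (trap_hcat p q).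

(* t_{1,1} o ... o t_{k,k} *)
Fixpoint trap_gtrace k : P k k -> P 0 0 :=
  match k return P k k -> P 0 0 with
  | 0 => fun x => x
  | k'.+1 => fun x => @trap_gtrace k' (trap_tr ord_max ord_max x)
  end.

End Operations.

(* Main.v *)
Require Import Defs.
From mathcomp Require Import all_boot all_fingroup.

(** Read graphically, [trap_gtrace x] closes up [x] by joining its n-th input
to its n-th output, for every n, and the partial traces may be taken in any
order.  Both identities come from two consequences of this.

- [gtrace_tr]: any diagonal partial trace may be taken first.  Tracing the
  blocks of [trap_hcat p q] one wire at a time, starting with those of [p],
  then gives multiplicativity ([gtrace_hcat]).

- [gtrace_lact]: the generalised trace is a class function, in the form
  Tr (s . x) = Tr (x . s).

For cyclicity, the vertical composite contracts [trap_hcat q p] along the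
inner wires only, and the generalised trace joins the remaining ones.  Taken
together these joins are the pairing of inputs and outputs given by a block
swap c, so that Tr (p o q) = Tr (c . (q * p)) ([gtrace_contract]).  The
commutativity axiom of the horizontal concatenation rewrites c . (q * p) as
(p * q) . c', where c' is the opposite block swap; sliding c' to the left by
[gtrace_lact] gives Tr (c' . (p * q)), which is Tr (q o p).

As l + k and k + l are not convertible, c . (q * p) only has a generalised
trace after transport along [addnC].  The lemmas on block swaps are therefore
stated in an arbitrary arity N equal to both sums, and block swaps are
recognised by their values. *)

Set Implicit Arguments.
Unset Strict Implicit.
Unset Printing Implicit Defensive.

Lemma lift_perm_del n (s : 'S_n.+1) (q : 'I_n.+1) (i : 'I_n) :
  lift q (perm_del s q i) = s (lift (s^-1%g q) i).
Proof. by rewrite permE lift_perm_del_fun. Qed.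

Lemma perm_del1 n (q : 'I_n.+1) : perm_del 1%g q = 1%g.
Proof.
apply/permP => i; apply: (@lift_inj _ q).
by rewrite lift_perm_del invg1 !perm1.
Qed.

(** The words of [s] and [s^-1] are the two rows of the graph of [s]; deleting
the letter [j] from one and the letter [s^-1 j] from the other removes the
same point of the graph. *)
Lemma perm_delV n (s : 'S_n.+1) (j : 'I_n.+1) :
  perm_del s^-1%g (s^-1%g j) = ((perm_del s j)^-1)%g.
Proof.
apply/eqP; rewrite eq_sym eq_invg_mul; apply/eqP/permP => i.
apply: (@lift_inj _ (s^-1%g j)).
by rewrite permM perm1 lift_perm_del invgK permKV lift_perm_del permK.
Qed.

(** [block_swap m n], transported to any arity equal to [m + n]. *)
Definition is_block_swap m n N (s : 'S_N) :=
  forall i : 'I_N, s i = (if i < m then i + n else i - m) :> nat.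

Lemma block_swapP m n : is_block_swap m n (block_swap m n).
Proof. by move=> i; rewrite permE block_swapE. Qed.

Lemma is_block_swap0 n (s : 'S_n) : is_block_swap 0 n s -> s = 1%g.
Proof.
by move=> hs; apply/permP => i; apply: val_inj; rewrite /= hs subn0 perm1.
Qed.

Lemma is_block_swapV_max m n N (s : 'S_N.+1) :
  m + n = N -> is_block_swap m.+1 n s -> s^-1%g ord_max = m :> nat.
Proof.
move=> eN hs; have mN : m < N.+1 by rewrite ltnS -eN leq_addr.
rewrite -[m in RHS]/(val (Ordinal mN)); congr (val _).
apply: (canLR (permK s)); apply: val_inj.
by rewrite /= hs /= ltnSn eN.
Qed.

(** The largest letter of the word of a block swap ends its first block. *)
Lemma is_block_swap_del m n N (s : 'S_N.+1) :
  m + n = N -> is_block_swap m.+1 n s ->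
  is_block_swap m n (perm_del s ord_max).
Proof.
move=> eN hs i; rewrite -[LHS]lift_max lift_perm_del hs /=.
rewrite (is_block_swapV_max eN hs) /bump.
have [mi | im] := leqP m i; first by rewrite add1n ltnS ltnNge mi subSS.
by rewrite add0n ltnS (ltnW im).
Qed.

Lemma cast_fam_id (X : nat -> nat -> Type) k l (ek : k = k) (el : l = l)
    (x : X k l) :
  cast_fam ek el x = x.
Proof. by rewrite (eq_irrelevance ek erefl) (eq_irrelevance el erefl). Qed.

Lemma cast_fam_trans (X : nat -> nat -> Type) k l k' l' k'' l''
    (ek : k = k') (el : l = l') (ek' : k' = k'') (el' : l' = l'')
    (ek2 : k = k'') (el2 : l = l'') (x : X k l) :
  cast_fam ek' el' (cast_fam ek el x) = cast_fam ek2 el2 x.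
Proof.
by move: ek' el' ek2 el2; case: _ / ek; case: _ / el; case: _ /; case: _ / => *;
  rewrite !cast_fam_id.
Qed.

Lemma tr_cast (P : trap) k l k' l' (ek : k.+1 = k'.+1) (el : l.+1 = l'.+1)
    (ek' : k = k') (el' : l = l') (i : 'I_k.+1) (j : 'I_l.+1)
    (i' : 'I_k'.+1) (j' : 'I_l'.+1) (p : P k.+1 l.+1) :
    i = i' :> nat -> j = j' :> nat ->
  trap_tr i' j' (cast_fam ek el p) = cast_fam ek' el' (trap_tr i j p).
Proof.
move: ek el i' j'; case: _ / ek'; case: _ / el' => ek el i' j'.
by rewrite !cast_fam_id => /val_inj -> /val_inj ->.
Qed.

(** The two sides of the commutativity axiom have l + k outputs and k + l
inputs, and the two block swaps act in different arities; only after moving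
everything to one arity N can they be traced and compared. *)
Lemma hcatC_cast (P : trap) k l N (en : k + l = N) (em : l + k = N)
    (p : P k l) (q : P l k) (s t : 'S_N) :
    is_block_swap l k s -> is_block_swap k l t ->
  trap_lact s (cast_fam en em (trap_hcat p q)) =
  trap_ract (cast_fam em en (trap_hcat q p)) t.
Proof.
have := trap_hcatC p q.
move: (addnC l k) (addnC k l) (@block_swapP l k) (@block_swapP k l).
move: (block_swap l k) (block_swap k l) (trap_hcat p q) (trap_hcat q p).
move: en em; move: (k + l) (l + k) => a b ea.
case: _ / ea s t => s t eb; case: _ / eb s t => s t s' t' x y e1 e2 hs' ht'.
rewrite !cast_fam_id => e hs ht.
have -> : s = s' by apply/permP => i; apply: val_inj; rewrite /= hs hs'.
by have -> : t = t' by apply/permP => i; apply: val_inj; rewrite /= ht ht'.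
Qed.

Section GeneralisedTrace.
Variable P : trap.

Lemma tr_lact k l (i : 'I_k.+1) (j : 'I_l.+1) (s : 'S_l.+1)
    (p : P k.+1 l.+1) :
  trap_tr i j (trap_lact s p) =
  trap_lact (perm_del s j) (trap_tr i (s^-1%g j) p).
Proof.
by rewrite -[trap_lact s p]trap_ract1 trap_tr_act perm1 perm_del1 trap_ract1.
Qed.

(** Two diagonal partial traces commute up to renumbering: the partial trace
of the last wires, with which the generalised trace starts, can be moved
before [trap_tr i i], which is then absorbed by induction. *)
Lemma gtrace_tr k (i : 'I_k.+1) (x : P k.+1 k.+1) :
  trap_gtrace (trap_tr i i x) = trap_gtrace x.
Proof.
elim: k i x => [|k IH] i x; first by rewrite (ord1 i) /= (ord1 ord_max).
have [-> //|ni] := eqVneq i ord_max.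
have le_ik : i <= k.
  by rewrite -ltnS ltn_neqAle -(inj_eq val_inj) /= in ni *; rewrite ni -ltnS /=.
have inord_max : inord k.+1 = ord_max :> 'I_k.+2.
  by apply: val_inj; rewrite /= inordK.
have -> : trap_gtrace (trap_tr i i x) =
    trap_gtrace (trap_tr ord_max ord_max (trap_tr i i x)) by [].
by rewrite trap_tr_gege //= inord_max IH.
Qed.

Lemma gtrace_conj k (s : 'S_k) (x : P k k) :
  trap_gtrace (trap_ract (trap_lact s x) s^-1%g) = trap_gtrace x.
Proof.
elim: k s x => [|k IH] s x.
  have -> : s = 1%g by apply/permP => -[].
  by rewrite invg1 trap_ract1 trap_lact1.
(* Tracing the last wires of s x s^-1 amounts to tracing the diagonal wires
   s^-1 ord_max of x, and leaves a conjugate by a smaller permutation. *)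
by rewrite [LHS]/= trap_tr_act perm_delV IH gtrace_tr.
Qed.

Lemma gtrace_lact k (s : 'S_k) (x : P k k) :
  trap_gtrace (trap_lact s x) = trap_gtrace (trap_ract x s).
Proof.
rewrite -[RHS](gtrace_conj s) trap_actC -trap_ractM mulVg.
by rewrite trap_ract1.
Qed.

Lemma gtrace_hcat k l (p : P k k) (q : P l l) :
  trap_gtrace (trap_hcat p q) = trap_hcat (trap_gtrace p) (trap_gtrace q).
Proof.
elim: k p => [|k IH] p.
  elim: l q => [//|l IH] q /=; rewrite -IH; congr trap_gtrace.
  rewrite -trap_tr_hcatr cast_fam_id.
  by congr (trap_tr _ _ _); apply: val_inj.
by rewrite /= -IH -trap_tr_hcatl; exact/esym/gtrace_tr.
Qed.

(** The contraction joins the input k + i to the output i, and the generalised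
trace of the result joins the input i to the output l + i.  A left action by
a block swap moves the outputs so that both become diagonal. *)
Lemma gtrace_contract k l N (en : k + l = N) (em : l + k = N)
    (x : P (k + l) (l + k)) (s : 'S_N) :
    is_block_swap l k s ->
  trap_gtrace (trap_contract x) = trap_gtrace (trap_lact s (cast_fam en em x)).
Proof.
elim: l N en em x s => [|l IH] N en em x s hs.
  move: en s hs; case: _ / em => en s hs.
  by rewrite (is_block_swap0 hs) trap_lact1 (eq_irrelevance en (addn0 k)).
case: N en em s hs => [|N] en em s hs; first by [].
have em' : l + k = N by case: em.
have en' : k + l = N by rewrite addnC.
rewrite [LHS]/= [RHS]/= tr_lact (IH N en' em' _ (perm_del s ord_max)); last first.
  exact: is_block_swap_del.
congr (trap_gtrace (trap_lact _ _)).
rewrite -(cast_fam_trans (addnS k l) (erefl (l + k).+1) (congr1 succn en') em).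
apply/esym/tr_cast => //=.
by rewrite (is_block_swapV_max em' hs).
Qed.

Lemma gtrace_vcompC k l (p : P k l) (q : P l k) :
  trap_gtrace (trap_vcomp p q) = trap_gtrace (trap_vcomp q p).
Proof.
pose s' : 'S_(k + l) := cast_perm (addnC l k) (block_swap l k).
have hs' : is_block_swap l k s'.
  move=> i; rewrite /s' cast_permE /=.
  exact: block_swapP.
rewrite /trap_vcomp (gtrace_contract (addnC l k) erefl _ (@block_swapP k l)).
rewrite (gtrace_contract erefl (addnC l k) _ hs').
by rewrite (hcatC_cast _ _ q p (@block_swapP k l) hs') gtrace_lact.
Qed.

End GeneralisedTrace.

Theorem proposition4p2p1 (P : trap) :
  (forall (k l : nat) (p : P k l) (q : P l k),
      trap_gtrace (trap_vcomp p q) = trap_gtrace (trap_vcomp q p)) /\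
  (forall (k l : nat) (p : P k k) (q : P l l),
      trap_gtrace (trap_hcat p q) = trap_hcat (trap_gtrace p) (trap_gtrace q)).
Proof. by split=> k l p q; [exact: gtrace_vcompC | exact: gtrace_hcat]. Qed.
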